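(* Let $k>3$ be an integer. Then all positive integer solutions $(x,y)$ of the equation $x^{2}-(k^{2}-4)y^{2}=4$ are given by $$(x,y)=(V_{n}(k,-1),U_{n}(k,-1))$$ with $n\geq 1$. That is, the set of pairs of positive integers solving the equation is exactly the set of these pairs as $n$ ranges over the integers $n\ge 1$.
   Context: For nonzero integers $k,s$ with $k^{2}+4s>0$, the generalized Fibonacci sequence is defined by $U_{0}(k,s)=0$, $U_{1}(k,s)=1$, $U_{n+1}(k,s)=kU_{n}(k,s)+sU_{n-1}(k,s)$ for $n\ge 1$, and the generalized Lucas sequence by $V_{0}(k,s)=2$, $V_{1}(k,s)=k$, $V_{n+1}(k,s)=kV_{n}(k,s)+sV_{n-1}(k,s)$ for $n\ge 1$. *)

(* Defs.v *)
From Stdlib Require Import ZArith.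

Open Scope Z_scope.

(* Generalized Fibonacci and Lucas sequences, defined for all integers k and s;
   the usual conditions k <> 0, s <> 0 and k ^ 2 + 4 * s > 0 are left to the
   statements that use them. *)
Fixpoint U (k s : Z) (n : nat) {struct n} : Z :=
  match n with
  | O => 0
  | S O => 1
  | S (S p as m) => k * U k s m + s * U k s p
  end.

Fixpoint V (k s : Z) (n : nat) {struct n} : Z :=
  match n with
  | O => 2
  | S O => k
  | S (S p as m) => k * V k s m + s * V k s p
  end.

(* Main.v *)
Require Import Defs.
From Stdlib Require Import ZArith Lia.
Open Scope Z_scope.

(** The substitution [x = k * y - 2 * z] turns [x ^ 2 - (k ^ 2 - 4) * y ^ 2 = 4]
    into [y ^ 2 - k * y * z + z ^ 2 = 1], and matches, for [s = -1], the identity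
    [V (n + 1) = k * U (n + 1) - 2 * U n] ([V_succ_eq_U]).  A positive solution
    makes [k * y - x] even and gives [0 <= z < y], so the theorem says that the
    solutions of the quadratic form with [0 <= z < y] are exactly the pairs of
    consecutive terms [(U (n + 1), U n)].

    The form is invariant under [(y, z) -> (z, k * z - y)], which runs the
    recurrence of [U] backwards.  This gives both directions: consecutive terms
    satisfy the form since [(1, 0)] does ([U_consecutive_form]), and every
    solution descends to [(1, 0)] ([form_solution_consecutive_U]). *)

Lemma U_step (k s : Z) (n : nat) :
  U k s (S (S n)) = k * U k s (S n) + s * U k s n.
Proof. reflexivity. Qed.

Lemma V_step (k s : Z) (n : nat) :
  V k s (S (S n)) = k * V k s (S n) + s * V k s n.
Proof. reflexivity. Qed.

(** Both sides satisfy the same second-order recurrence, so the induction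
    carries two consecutive instances. *)
Lemma V_succ_eq_U (k s : Z) (n : nat) :
  V k s (S n) = k * U k s (S n) + 2 * s * U k s n.
Proof.
  enough (V k s (S n) = k * U k s (S n) + 2 * s * U k s n /\
          V k s (S (S n)) = k * U k s (S (S n)) + 2 * s * U k s (S n)) by tauto.
  induction n as [|n [IH0 IH1]].
  - cbn [U V]. split; ring.
  - split; [exact IH1|].
    rewrite (V_step k s (S n)), IH1, IH0, (U_step k s (S n)), (U_step k s n).
    ring.
Qed.

Lemma U_consecutive_form (k : Z) (n : nat) :
  U k (-1) (S n) ^ 2 - k * U k (-1) (S n) * U k (-1) n + U k (-1) n ^ 2 = 1.
Proof.
  induction n as [|n IH].
  - cbn [U]. ring.
  - rewrite U_step, <- IH. ring.
Qed.

Lemma U_nonneg_increasing (k : Z) (hk : 2 <= k) (n : nat) :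
  0 <= U k (-1) n < U k (-1) (S n).
Proof.
  induction n as [|n IH].
  - cbn [U]. lia.
  - rewrite U_step. nia.
Qed.

(** Descent on [z].  If [z > 0], put [w = k * z - y]; the form reads
    [y * w = z ^ 2 - 1], and [0 <= z ^ 2 - 1 < z ^ 2 <= y * z] forces
    [0 <= w < z], so [(z, w)] is a smaller solution of the same kind.
    If [z = 0], then [y = 1]. *)
Lemma form_solution_consecutive_U (k y z : Z) :
  0 <= z < y -> y ^ 2 - k * y * z + z ^ 2 = 1 ->
  exists n : nat, y = U k (-1) (S n) /\ z = U k (-1) n.
Proof.
  intros Hzy.
  assert (Hz : 0 <= z) by lia.
  revert y Hzy.
  pattern z; apply Zlt_0_ind; [clear z Hz | exact Hz].
  intros z IH _ y Hzy Hform.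
  destruct (Z.eq_dec z 0) as [->|Hz0].
  - exists 0%nat. cbn [U]. nia.
  - assert (Hprod : y * (k * z - y) = z * z - 1) by nia.
    assert (Hw : 0 <= k * z - y < z).
    { generalize dependent (k * z - y). intros w Hprod. nia. }
    destruct (IH (k * z - y) Hw z Hw) as [n [Hn1 Hn0]].
    + rewrite <- Hform. ring.
    + exists (S n). split; [|exact Hn1].
      rewrite U_step, <- Hn1, <- Hn0. ring.
Qed.

(** Modulo 2 the equation reads [x ^ 2 = (k * y) ^ 2], so [k * y - x] is even;
    half of it is [z].  Both bounds on [z] compare squares: [z >= 0] is
    [x <= k * y], and [z < y] is [x > (k - 2) * y]. *)
Lemma pell_solution_to_form (k x y : Z) (hk : 2 <= k) :
  0 < x -> 0 < y -> x ^ 2 - (k ^ 2 - 4) * y ^ 2 = 4 ->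
  exists z : Z, x = k * y - 2 * z /\ 0 <= z < y /\
                y ^ 2 - k * y * z + z ^ 2 = 1.
Proof.
  intros Hx Hy Heq.
  destruct (Z.Even_or_Odd (k * y - x)) as [[z Hz]|[m Hm]].
  - exists z.
    assert (Hxz : x = k * y - 2 * z) by lia.
    split; [exact Hxz|].
    split.
    + assert (x <= k * y).
      { apply (Z.square_le_simpl_nonneg x (k * y)); nia. }
      assert ((k - 2) * y < x).
      { apply (Z.square_lt_simpl_nonneg ((k - 2) * y) x); [lia|].
        assert (0 <= (k - 2) * (y * y)) by nia.
        replace (x * x) with ((k ^ 2 - 4) * y ^ 2 + 4) by lia.
        nia. }
      lia.
    + subst x. nia.
  - exfalso.
    assert (Hxm : x = k * y - 2 * m - 1) by lia.
    subst x. ring_simplify in Heq. lia.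
Qed.

Theorem theorem12 (k : Z) (hk : 3 < k) (x y : Z) :
  (0 < x /\ 0 < y /\ x ^ 2 - (k ^ 2 - 4) * y ^ 2 = 4) <->
  (exists n : nat, (1 <= n)%nat /\ (x, y) = (V k (-1) n, U k (-1) n)).
Proof.
  split.
  - intros [Hx [Hy Heq]].
    destruct (pell_solution_to_form k x y ltac:(lia) Hx Hy Heq)
      as [z [Hxz [Hzy Hform]]].
    destruct (form_solution_consecutive_U k y z Hzy Hform) as [n [Hn1 Hn0]].
    exists (S n). split; [lia|].
    rewrite V_succ_eq_U, <- Hn1, <- Hn0, Hxz. f_equal. ring.
  - intros [[|n] [Hn Hxy]]; [lia|].
    apply pair_equal_spec in Hxy as [-> ->].
    pose proof (U_nonneg_increasing k ltac:(lia) n) as Hinc.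
    pose proof (U_consecutive_form k n) as Hform.
    rewrite V_succ_eq_U.
    generalize dependent (U k (-1) (S n)). intros y Hinc Hform.
    generalize dependent (U k (-1) n). intros z Hinc Hform.
    repeat split; nia.
Qed.
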